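(* For every fixed integer $d\ge 4$, $\mathrm{ncs}_d(N)\in 2^{\Omega(N\log N)}$ (as $N\to\infty$ over positive integers). That is, there are a constant $c_d>0$ and an integer $N_d$, depending only on $d$, such that for all integers $N\ge N_d$ there is a $d$-dimensional grid of volume at most $N$ on which at least $2^{c_dN\log N}$ distinct crossing-free (proper) geometric grid graphs can be drawn.
   Context: Let $\mathbb{N}=\{1,2,3,\dots\}$. For positive integers $X_1,\dots,X_d$, the $X_1\times\cdots\times X_d$ grid is the set $\mathbb{N}(X_1,\dots,X_d)=\{(x_1,\dots,x_d): x_i\in\{1,\dots,X_i\}\text{ for all }i\}\subset\mathbb{N}^d$; its volume is $\prod_{i=1}^d X_i$. A $d$-dimensional geometric grid graph $G$ is a finite simple graph whose vertex set is a subset of $\mathbb{N}^d$; each edge $uw$ is identified with the open straight line segment with endpoints $u$ and $w$. All geometric grid graphs are assumed to be proper: for every edge $uw\in E(G)$ and every vertex $x\in V(G)$, the point $x$ does not lie on the open segment $uw$. Two distinct edges cross if, as open segments, they have a point in common; $\mathrm{cr}(G)$ is the number of unordered pairs of distinct edges that cross, and $G$ is crossing-free if $\mathrm{cr}(G)=0$. Define $$\mathrm{ncs}_d(N)=\max\Bigl\{\bigl|\{G: G\text{ a (proper) geometric grid graph},\ V(G)\subseteq \mathbb{N}(X_1,\dots,X_d),\ \mathrm{cr}(G)=0\}\bigr| : X_1,\dots,X_d\ \text{positive integers},\ \textstyle\prod_{i=1}^d X_i\le N\Bigr\}.$$ *)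

(* Defs.v *)
From HB Require Import structures.
From mathcomp Require Import all_boot all_order all_algebra finmap.
From mathcomp Require Import all_classical all_reals all_analysis.

Set Implicit Arguments.
Unset Strict Implicit.
Unset Printing Implicit Defensive.

Import Order.TTheory GRing.Theory Num.Theory.

Local Open Scope classical_set_scope.
Local Open Scope fset_scope.
Local Open Scope ring_scope.

(* Coordinates are arbitrary naturals here; positivity is enforced by [grid]. *)
Definition lattice_point (d : nat) := {ffun 'I_d -> nat}.

(* The shift by one makes the i-th coordinate range over 1, ..., X i. *)
Definition grid (d : nat) (X : 'I_d -> nat) : {fset lattice_point d} :=
  [fset x in [seq ([ffun i => (y i).+1] : lattice_point d) |
                y : {dffun forall i : 'I_d, 'I_(X i)}]].

Definition volume (d : nat) (X : 'I_d -> nat) : nat := (\prod_(i < d) X i)%N.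

Lemma in_grid (d : nat) (X : 'I_d -> nat) (x : lattice_point d) :
  (x \in grid X) = [forall i, 0 < x i <= X i]%N.
Proof.
rewrite inE /=; apply/mapP/forallP => [[y _ ->] i|xX].
  by rewrite ffunE /=.
have ltX i : ((x i).-1 < X i)%N by case/andP: (xX i); case: (x i).
exists [ffun i => Ordinal (ltX i)]; first by rewrite mem_enum.
by apply/ffunP => i; rewrite !ffunE /= prednK //; case/andP: (xX i).
Qed.

(* A pair (V, E); an edge is the set of its two endpoints. *)
Definition graph (d : nat) : Type :=
  ({fset lattice_point d} * {fset {fset lattice_point d}})%type.

Definition vertices (d : nat) (G : graph d) : {fset lattice_point d} := G.1.
Definition edges (d : nat) (G : graph d) : {fset {fset lattice_point d}} := G.2.

Definition simple_graph (d : nat) (G : graph d) : Prop :=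
  forall e, e \in edges G -> e `<=` vertices G /\ #|` e| = 2%N.

Definition embed (R : realType) (d : nat) (x : lattice_point d) : 'rV[R]_d :=
  \row_i (x i)%:R.

Definition open_segment (R : realType) (d : nat) (a b : 'rV[R]_d) :
    set 'rV[R]_d :=
  [set z | exists t : R, 0 < t < 1 /\ z = (1 - t) *: a + t *: b]%classic.

(* On a two-element set {u, w} this is the single open segment between u and w;
   see [edge_segment2]. *)
Definition edge_segment (R : realType) (d : nat) (e : {fset lattice_point d}) :
    set 'rV[R]_d :=
  [set z | exists u w, [/\ u \in e, w \in e, u != w &
    open_segment (embed R u) (embed R w) z]]%classic.

Lemma edge_segment2 (R : realType) (d : nat) (u w : lattice_point d) : u != w ->
  edge_segment [fset u; w] = open_segment (embed R u) (embed R w).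
Proof.
move=> uw; apply/seteqP; split => z /=; last first.
  by move=> zuw; exists u, w; split; rewrite ?inE ?eqxx ?orbT.
case=> a [b []]; rewrite !inE => /orP[]/eqP-> /orP[]/eqP->; rewrite ?eqxx//.
move=> _ [t [/andP[t0 t1] ->]]; exists (1 - t); split.
  by rewrite subr_gt0 t1 ltrBlDr ltrDl.
by rewrite subKr addrC.
Qed.

Definition proper_graph (R : realType) (d : nat) (G : graph d) : Prop :=
  forall e x, e \in edges G -> x \in vertices G ->
    ~ edge_segment e (embed R x).

Definition geometric_grid_graph (R : realType) (d : nat) (G : graph d) : Prop :=
  simple_graph G /\ proper_graph R G.

Definition cross (R : realType) (d : nat) (e f : {fset lattice_point d}) : Prop :=
  e <> f /\ (edge_segment (R := R) e `&` edge_segment f !=set0)%classic.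

(* Unordered pairs of distinct edges are two-element subsets of the edge set. *)
Definition cr (R : realType) (d : nat) (G : graph d) : nat :=
  #|` [fset p in fpowerset (edges G) |
        `[< exists e f, p = [fset e; f] /\ cross R e f >] ] |.

Definition crossing_free (R : realType) (d : nat) (G : graph d) : Prop :=
  cr R G = 0%N.

(* Every simple graph with vertices in the grid belongs to the ambient finite
   product; see [in_crossing_free_graphs]. *)
Definition crossing_free_graphs (R : realType) (d : nat) (X : 'I_d -> nat) :
    {fset graph d} :=
  [fset G in fpowerset (grid X) `*` fpowerset (fpowerset (grid X)) |
    `[< geometric_grid_graph R G /\ crossing_free R G >] ].

Lemma in_crossing_free_graphs (R : realType) (d : nat) (X : 'I_d -> nat)
    (G : graph d) :
  G \in crossing_free_graphs R X <->
  [/\ geometric_grid_graph R G, vertices G `<=` grid X & crossing_free R G].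
Proof.
rewrite !inE /= !fpowersetE; split.
  by case/andP=> /andP[VX _] /asboolP[].
case=> Ggeo VX Gcf; apply/andP; split; last exact/asboolP.
apply/andP; split=> //; apply/fsubsetP => e eG; rewrite fpowersetE.
by apply: fsubset_trans VX; case: Ggeo => /(_ e eG)[].
Qed.

(* Positive sides with product at most N are themselves at most N, so bounding
   them by N loses no grid; see [ncs_ge]. *)
Definition ncs (R : realType) (d N : nat) : nat :=
  (\max_(X : {ffun 'I_d -> 'I_N.+1} |
         [forall i, 0 < X i] && (volume (fun i => X i) <= N))
     #|` crossing_free_graphs R (fun i => X i : nat)|)%N.

Lemma ncs_ge (R : realType) (d N : nat) (X : 'I_d -> nat) :
  (forall i, 0 < X i)%N -> (volume X <= N)%N ->
  (#|` crossing_free_graphs R X| <= ncs R d N)%N.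
Proof.
move=> X_gt0 XN.
have leX i : (X i < N.+1)%N.
  rewrite ltnS (leq_trans _ XN)// /volume (bigD1 i)//= leq_pmulr//.
  exact: prodn_gt0.
pose Y : {ffun 'I_d -> 'I_N.+1} := [ffun i => Ordinal (leX i)].
have YX : (fun i => Y i : nat) = X by apply/funext => i; rewrite ffunE.
rewrite -{1}YX /ncs; apply: (leq_bigmax_cond
  (F := fun Z : {ffun 'I_d -> 'I_N.+1} =>
    #|` crossing_free_graphs R (fun i => Z i : nat)|) Y).
by rewrite YX XN andbT; apply/forallP => i; rewrite ffunE; exact: X_gt0.
Qed.

Lemma ncs_attained (R : realType) (d N : nat) : (0 < N)%N ->
  exists X : 'I_d -> nat, [/\ (forall i, 0 < X i)%N, (volume X <= N)%N &
    ncs R d N = #|` crossing_free_graphs R X|].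
Proof.
move=> N_gt0; pose P (X : {ffun 'I_d -> 'I_N.+1}) :=
  [forall i, (0 < X i)%N] && (volume (fun i => X i) <= N)%N.
have P1 : (0 < #|P|)%N.
  apply/card_gt0P; exists [ffun=> inord 1]; apply/andP; split.
    by apply/forallP => i; rewrite ffunE inordK.
  by rewrite /volume big1// => i _; rewrite ffunE inordK.
have [X /andP[/forallP X_gt0 XN] eqX] := eq_bigmax_cond
  (fun Z : {ffun 'I_d -> 'I_N.+1} =>
    #|` crossing_free_graphs R (fun i => Z i : nat)|) P1.
by exists (fun i => X i : nat); split.
Qed.

(* Main.v *)
Require Import Defs.
From mathcomp Require Import all_boot all_order all_algebra.
From mathcomp Require Import all_classical all_reals all_analysis.
From mathcomp Require Import finmap.
From mathcomp Require Import ring lra zify.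

Import Order.TTheory GRing.Theory Num.Theory.

Local Open Scope ring_scope.

(** The grid consists of two parallel copies (layers) of a three-dimensional cube
    of side 16 k, at heights 1 and 2 in the fourth coordinate, all further
    coordinates being 1.  Every point [a] of the k x k x k cube gives the vertex
    [L a] of the lower layer, where L = 8, and one edge from it to [L a + s] in
    the upper layer, where the slope [s = f a] is chosen in a cube of side
    n = L k.  No lattice point has height strictly between 1 and 2, so such a
    graph is proper whatever [f] is, and distinct [f] give distinct graphs.

    Crossings: two such edges can only meet at the same height [1 + t], where
    [L a + t s = L a' + t s']; hence [s - s' = (L / t) (a' - a)] with t < 1, that
    is, [s - s' = r (a' - a)] for a rational r > L ([slope_edge_cross]).  Writing
    r = b / g in lowest terms makes both differences multiples of one integer
    vector, [s - s' = b w] and [a' - a = g w] with L g < b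
    ([rat_proportional]).  Since the slopes lie in a cube of side n, the
    coordinates of [w] are at most n / b in absolute value.

    Counting: fix [a] and the slopes chosen at all other points.  A forbidden
    slope at [a] is determined by (b, g, w), so there are at most
    [sum_(b > L) (b / L) (3 n / b)^3 <= 27 n^3 / L^2] of them
    ([card_collisions_le]).  It is the summability of 1 / b^2 that makes three
    dimensions in each layer, hence four in all, enough; two would leave a
    divergent harmonic sum.  For L = 8 this forbids fewer than half of the n^3
    slopes, and at least k^3 remain.

    Choosing the slopes one point at a time ([greedy_selection]) gives at least
    (k^3)^(k^3) crossing-free graphs.  With k as large
    as the volume bound N permits, k^3 is a constant fraction of N, hence at least
    the square root of N for large N, and this number is 2^(Omega(N log N)). *)

(** * Greedy choices *)

(** The points of [A] choose one after the other; the free set in the hypothesis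
    is computed against all of [f], so it is contained in the set of values that
    avoid a conflict with the points that have already chosen.  Symmetry of the
    conflict relation turns this into the absence of conflicts in both orders. *)
Lemma greedy_selection (A S : finType) (s0 : S) (K : nat)
    (conflict : A -> S -> A -> S -> bool) :
  (forall a s a' s', conflict a s a' s' -> conflict a' s' a s) ->
  (forall (a : A) (f : {ffun A -> S}),
    (K <= #|[set s | [forall (a' | a' != a), ~~ conflict a s a' (f a')]]|)%N) ->
  (K ^ #|A| <= #|[set f : {ffun A -> S} |
     [forall a, forall (a' | a' != a), ~~ conflict a (f a) a' (f a')]]|)%N.
Proof.
move=> conflict_sym free_card.
(* Partial choices on D are represented by total functions equal to s0 outside D. *)
pose good (D : {set A}) := [set f : {ffun A -> S} |
  [forall (a | a \notin D), f a == s0] &&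
  [forall a in D, forall (a' | (a' \in D) && (a' != a)),
     ~~ conflict a (f a) a' (f a')]].
pose free a f :=
  [set s | [forall (a' | a' != a), ~~ conflict a s a' ((f : {ffun A -> S}) a')]].
suff good_card n (D : {set A}) : #|D| = n -> (K ^ n <= #|good D|)%N.
  apply: leq_trans (good_card _ [set: A] (cardsT A)) _.
  apply/subset_leq_card/fintype.subsetP => f; rewrite !inE => /andP[_ /forall_inP fgood].
  apply/forallP => a; apply/forall_inP => a' a'a.
  by move/(_ a): fgood; rewrite inE => /(_ isT)/forall_inP; apply; rewrite inE.
elim: n D => [|n IH] D cardD.
  rewrite expn0; apply/card_gt0P; exists [ffun=> s0].
  have D0 : D = finset.set0 by apply/eqP; rewrite -cards_eq0 cardD.
  rewrite !inE D0; apply/andP; split; apply/forall_inP => a.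
    by rewrite ffunE.
  by rewrite inE.
have [a aD] : exists a, a \in D by apply/card_gt0P; rewrite cardD.
pose D' := (D :\ a)%SET.
have cardD' : #|D'| = n by move: cardD; rewrite (cardsD1 a) aD => -[].
pose W := [set p : {ffun A -> S} * S | (p.1 \in good D') && (p.2 \in free a p.1)].
have cardW : (K ^ n.+1 <= #|W|)%N.
  rewrite -sum1_card (eq_bigl (fun p : {ffun A -> S} * S =>
    (p.1 \in good D') && (p.2 \in free a p.1))); last by move=> p; rewrite inE.
  rewrite -(pair_big_dep (fun f => f \in good D') (fun f s => s \in free a f)
             (fun _ _ => 1%N)) /=.
  rewrite expnSr; apply: leq_trans (leq_mul (IH _ cardD') (leqnn K)) _.
  rewrite -sum_nat_const; apply: leq_sum => f _.
  by rewrite sum1_card; exact: free_card.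
apply: leq_trans cardW _.
pose upd (p : {ffun A -> S} * S) := [ffun x => if x == a then p.2 else p.1 x].
have upd_inj : {in W &, injective upd}.
  move=> [f s] [g t]; rewrite !inE /= => /andP[/andP[/forall_inP f0 _] _].
  move=> /andP[/andP[/forall_inP g0 _] _] /ffunP eq_upd.
  congr pair; last by have := eq_upd a; rewrite !ffunE eqxx.
  apply/ffunP => x; have := eq_upd x; rewrite !ffunE /=.
  case: eqVneq => // -> _.
  by rewrite (eqP (f0 a _)) ?(eqP (g0 a _)) // !inE eqxx.
rewrite -(card_in_imset upd_inj); apply: subset_leq_card.
apply/fintype.subsetP => _ /imsetP[[f s] /[swap] -> ].
rewrite !inE /= => /andP[/andP[/forall_inP f0 /forall_inP fgood] /forall_inP sfree].
apply/andP; split; apply/forall_inP => x.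
  move=> xD; have xa : x != a by apply: contraNneq xD => ->.
  by rewrite ffunE /= (negbTE xa) f0// !inE negb_and xD orbT.
move=> xD; apply/forall_inP => y /andP[yD yx]; rewrite !ffunE /=.
case: (eqVneq x a) yx => [-> ya|xa yx]; first by rewrite (negbTE ya) sfree.
case: (eqVneq y a) => [->|ya].
  by apply: contra (sfree x xa); exact: conflict_sym.
move/(_ x): fgood; rewrite !inE xa xD => /(_ isT)/forall_inP; apply.
by rewrite !inE ya yD.
Qed.

(** * Forbidden slopes *)

(** In lowest terms r = b / g, the equation [g x = b y] makes g divide every
    coordinate of [y] by coprimality, and [w] is the quotient. *)
Lemma rat_proportional (I : Type) (x y : I -> int) (r : rat) :
  (forall i, (x i)%:Q = r * (y i)%:Q) ->
  exists w : I -> int, forall i, x i = numq r * w i /\ y i = denq r * w i.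
Proof.
move=> xy; exists (fun i => (y i %/ denq r)%Z) => i.
have cross : denq r * x i = numq r * y i.
  apply: (@intr_inj rat); rewrite !rmorphM /= xy -{2}[r]divq_num_den.
  by field; rewrite intr_eq0 denq_neq0.
have yi : y i = denq r * (y i %/ denq r)%Z.
  rewrite [RHS]mulrC divzK//.
  rewrite -(@Gauss_dvdzr _ (numq r)); first by rewrite -cross dvdz_mulr.
  by rewrite coprimezE coprime_sym coprime_num_den.
split=> //; apply: (mulfI (denq_neq0 r)); rewrite cross {1}yi; ring.
Qed.

(** The crossing condition for the edges from [L a] to [L a + s] and from [L a']
    to [L a' + s'], with r = L / t when they meet at the fraction t of their
    length; see [slope_edge_cross]. *)
Definition collides {k n : nat} (L : nat) (a : {ffun 'I_3 -> 'I_k})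
    (s : {ffun 'I_3 -> 'I_n}) (a' : {ffun 'I_3 -> 'I_k})
    (s' : {ffun 'I_3 -> 'I_n}) : bool :=
  `[< exists r : rat, L%:R < r /\
      forall i, ((s i)%:Z - (s' i)%:Z)%:Q = r * ((a' i)%:Z - (a i)%:Z)%:Q >].

Lemma collides_sym k n L (a : {ffun 'I_3 -> 'I_k}) (s : {ffun 'I_3 -> 'I_n}) a' s' :
  collides L a s a' s' -> collides L a' s' a s.
Proof.
move=> /asboolP[r [Lr rP]]; apply/asboolP; exists r; split=> // i.
by rewrite -[LHS]opprK -rmorphN /= opprB rP -mulrN -rmorphN /= opprB.
Qed.

Lemma leq_card_witness (U S : finType) (r : U -> S -> Prop) (F : {set S}) :
  (forall u s s', r u s -> r u s' -> s = s') ->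
  (forall s, s \in F -> exists u, r u s) -> (#|F| <= #|U|)%N.
Proof.
move=> r_fun Fr.
have [->|[s0 /Fr[u0 _]]] := set_0Vmem F; first by rewrite cards0.
have {}Fr s : exists u, s \in F -> r u s.
  by case: (boolP (s \in F)) => [/Fr[u ru]|_]; [exists u|exists u0].
have [c cP] := choice Fr.
apply: (@leq_card_in _ _ c) => s s' /cP rs /cP rs' cc.
by apply: r_fun rs _; rewrite cc.
Qed.

Lemma card_bigcup_leq (I S : finType) (P : pred I) (F : I -> {set S}) :
  (#|\bigcup_(i | P i) F i| <= \sum_(i | P i) #|F i|)%N.
Proof.
elim/big_rec2: _ => [|i m B _ IH]; first by rewrite cards0.
by rewrite (leq_trans (leq_card_setU _ _))// leq_add2l.
Qed.

(** Telescoping: 1 / b^2 <= 1 / (b - 1) - 1 / b. *)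
Lemma sum_inv_sqr_le (F : realFieldType) (L n : nat) : (0 < L)%N ->
  \sum_(L.+1 <= b < n) (b%:R ^+ 2)^-1 <= L%:R^-1 :> F.
Proof.
move=> L_gt0; have [nL|Ln] := leqP n L.
  by rewrite big_geq ?invr_ge0// leqW.
suff H : \sum_(L.+1 <= b < n) (b%:R ^+ 2)^-1 <= L%:R^-1 - n.-1%:R^-1 :> F.
  by apply: le_trans H _; rewrite gerBl invr_ge0.
elim: n Ln => // n IH; rewrite ltnS leq_eqVlt => /predU1P[<-|Ln].
  by rewrite big_geq// subrr.
rewrite big_nat_recr//= -lerBrDr (le_trans (IH Ln))// lerBrDr -lerBrDl.
have n1 : 0 < n.-1%:R :> F by rewrite ltr0n; lia.
rewrite -[in n%:R](ltn_predK Ln) -natr1; set x : F := n.-1%:R in n1 *.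
have -> : L%:R^-1 - (x + 1)^-1 - (L%:R^-1 - x^-1) = (x * (x + 1))^-1 :> F.
  by field; rewrite natr1 !pnatr_eq0; lia.
have x1 : 0 < x + 1 by rewrite addr_gt0.
by rewrite lef_pV2 ?posrE ?exprn_gt0 ?mulr_gt0// expr2 ler_wpM2r ?ltW// ltrDl.
Qed.

(** The sum bounds the number of triples (b, g, w): b / L values of g for each
    b, and at most (3 (n / b))^3 vectors [w].  Each term is at most
    27 n^3 / (L b^2). *)
Lemma weighted_sum_le (L n : nat) : (0 < L)%N ->
  (L ^ 2 * \sum_(L.+1 <= b < n) (b %/ L * (3 * (n %/ b)) ^ 3) <= 27 * n ^ 3)%N.
Proof.
move=> L_gt0; (* An abstract field prevents the constants from being computed in rat. *)
pose F : realFieldType := rat; clearbody F.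
rewrite -(ler_nat F) natrM natrX natr_sum.
have L0 : 0 < L%:R :> F by rewrite ltr0n.
apply: (@le_trans _ _ (L%:R ^+ 2 *
    (27 * n%:R ^+ 3 / L%:R * \sum_(L.+1 <= b < n) (b%:R ^+ 2)^-1))).
  rewrite ler_pM2l ?exprn_gt0// mulr_sumr big_nat_cond [leRHS]big_nat_cond.
  apply: ler_sum => b /andP[/andP[Lb bn] _].
  have b0 : 0 < b%:R :> F by rewrite ltr0n; lia.
  rewrite natrM natrX natrM.
  have H1 : (b %/ L)%:R <= b%:R / L%:R :> F.
    by rewrite ler_pdivlMr// -natrM ler_nat leq_divM.
  have H2 : (n %/ b)%:R <= n%:R / b%:R :> F.
    by rewrite ler_pdivlMr// -natrM ler_nat leq_divM.
  have -> : 27 * n%:R ^+ 3 / L%:R / b%:R ^+ 2 =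
            b%:R / L%:R * (3 * (n%:R / b%:R)) ^+ 3 :> F.
    by field; rewrite !lt0r_neq0.
  apply: ler_pM => //.
  by rewrite lerXn2r ?nnegrE ?mulr_ge0 ?divr_ge0// ler_pM2l.
apply: (@le_trans _ _ (L%:R ^+ 2 * (27 * n%:R ^+ 3 / L%:R * L%:R^-1))).
  rewrite ler_wpM2l ?exprn_ge0// ler_wpM2l ?sum_inv_sqr_le//.
rewrite natrM natrX le_eqVlt; apply/orP; left; apply/eqP.
by field; rewrite lt0r_neq0.
Qed.

(** Every forbidden slope is [s = f (a + g w) + b w] for some b > L, some g with
    0 < g <= b / L and some [w] with coordinates bounded by n / b. *)
Lemma card_collisions_le (k n L : nat) (a : {ffun 'I_3 -> 'I_k})
    (f : {ffun {ffun 'I_3 -> 'I_k} -> {ffun 'I_3 -> 'I_n}}) : (0 < L)%N ->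
  (L ^ 2 * #|[set s | [exists (a' | a' != a), collides L a s a' (f a')]]|
     <= 27 * n ^ 3)%N.
Proof.
move=> L_gt0; apply: leq_trans (weighted_sum_le L n L_gt0).
rewrite leq_mul2l; apply/orP; right.
(* U m encodes the vectors with coordinates in [-m, m], shifted by m. *)
pose U m := {ffun 'I_3 -> 'I_(2 * m).+1}.
pose hit (b g : nat) (u : U (n %/ b)%N) (s : {ffun 'I_3 -> 'I_n}) :=
  exists a' : {ffun 'I_3 -> 'I_k},
  (forall i, (a' i)%:Z - (a i)%:Z = g%:Z * ((u i)%:Z - (n %/ b)%N%:Z)) /\
  (forall i, (s i)%:Z - (f a' i)%:Z = b%:Z * ((u i)%:Z - (n %/ b)%N%:Z)).
pose B b g := [set s | `[< exists u, hit b g u s >]].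
have cardB b g : (0 < b < n)%N -> (#|B b g| <= (3 * (n %/ b)) ^ 3)%N.
  move=> /andP[b0 bn]; have m0 : (0 < n %/ b)%N by rewrite divn_gt0// ltnW.
  apply: (@leq_trans #|{: U (n %/ b)%N}|); last first.
    by rewrite card_ffun !card_ord leq_exp2r//; lia.
  apply: (@leq_card_witness _ _ (@hit b g)).
  - move=> u s s' [a1 [e1 h1]] [a2 [e2 h2]].
    have ea : a1 = a2.
      apply/ffunP => i; apply/val_inj; have := e1 i; have := e2 i; move=> <- /=.
      by move=> /addIr [].
    apply/ffunP => i; apply/val_inj; have := h1 i; rewrite ea -h2.
    by move=> /addIr [].
  - by move=> s; rewrite inE => /asboolP.
apply: (@leq_trans #|\bigcup_(b < n | (L < b)%N) \bigcup_(g < b %/ L) B b g.+1|);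
    last first.
  rewrite big_geq_mkord; apply: leq_trans (card_bigcup_leq _ _ _ _) _.
  apply: leq_sum => b Lb; apply: leq_trans (card_bigcup_leq _ _ _ _) _.
  rewrite -[X in (_ <= X * _)%N]card_ord -sum_nat_const; apply: leq_sum => g _.
  by apply: cardB; rewrite ltn_ord andbT (leq_ltn_trans _ Lb).
apply/subset_leq_card/fintype.subsetP => s; rewrite inE.
move=> /exists_inP[a' a'a /asboolP[r [Lr /rat_proportional [w wP]]]].
have r0 : 0 < r by rewrite (le_lt_trans _ Lr)// ler0n.
have : 0 < numq r by rewrite numq_gt0.
have : L%:Z * denq r < numq r.
  move: Lr; rewrite -[X in _ < X]divq_num_den ltr_pdivlMr ?ltr0z ?denq_gt0//.
  by rewrite -(ltr_int rat) rmorphM.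
have := denq_gt0 r; move: wP.
case: (numq r) => // b; case: (denq r) => // g wP; rewrite !ltz_nat => g0 Lgb b0.
(* w is nonzero because a' differs from a; this forces b < n. *)
have [i0 wi0] : exists i, w i != 0.
  apply/existsP; apply: contraNT a'a => /existsPn w0; apply/eqP/ffunP => i.
  apply/val_inj; have [_ /eqP] := wP i; have := w0 i; rewrite negbK => /eqP ->.
  by rewrite mulr0 subr_eq0 => /eqP[].
have bw i : (b * `|w i| < n)%N.
  rewrite -[b]/`|b%:Z|%N -abszM -(proj1 (wP i)).
  by case: (s i) (f a' i) => [u un] [v vn] /=; lia.
have bn : (b < n)%N by have := bw i0; nia.
have wn i : (`|w i| <= n %/ b)%N by rewrite leq_divRL// mulnC ltnW.
apply/bigcupP; exists (Ordinal bn) => /=; first nia.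
have gb : (g.-1 < b %/ L)%N by rewrite prednK// leq_divRL// mulnC; lia.
apply/bigcupP; exists (Ordinal gb) => //=; rewrite inE prednK//; apply/asboolP.
exists [ffun i => inord `|(w i + (n %/ b)%N%:Z)%R|%N]; exists a'.
have uw i : (inord `|(w i + (n %/ b)%N%:Z)%R|%N : 'I_(2 * (n %/ b)).+1)%:Z -
    (n %/ b)%N%:Z = w i.
  by rewrite inordK; have := wn i; lia.
by split=> i; rewrite ffunE uw; case: (wP i).
Qed.

(** * Two-layer graphs *)

Definition layer_point (d h : nat) (x : 'I_3 -> nat) : lattice_point d :=
  [ffun i : 'I_d => if (i < 3)%N then (x (inord i)).+1
                    else if i == 3 :> nat then h else 1%N].

Definition slope_edge (d L k n : nat) (a : {ffun 'I_3 -> 'I_k})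
    (s : {ffun 'I_3 -> 'I_n}) : {fset lattice_point d} :=
  [fset layer_point d 1 (fun i => L * a i)%N;
        layer_point d 2 (fun i => L * a i + s i)%N]%fset.

Definition slab (d m : nat) (i : 'I_d) : nat :=
  if (i < 3)%N then m else if i == 3 :> nat then 2%N else 1%N.

Definition slope_graph (d L k n : nat)
    (f : {ffun {ffun 'I_3 -> 'I_k} -> {ffun 'I_3 -> 'I_n}}) : graph d :=
  (grid (@slab d (L * k + n)),
   [fset slope_edge d L k n a (f a) | a : {ffun 'I_3 -> 'I_k}]%fset).

Section Slopes.
Variables (R : realType) (d L k n : nat) (d_ge4 : (4 <= d)%N).
Implicit Types (a : {ffun 'I_3 -> 'I_k}) (s : {ffun 'I_3 -> 'I_n}).

Let height_coord : 'I_d := Ordinal d_ge4.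
Let base_coord (j : 'I_3) : 'I_d := widen_ord (ltnW d_ge4) j.

Lemma layer_point_height h x : layer_point d h x height_coord = h.
Proof. by rewrite ffunE. Qed.

Lemma layer_point_base h x j : layer_point d h x (base_coord j) = (x j).+1.
Proof. by rewrite ffunE /= ltn_ord inord_val. Qed.

Lemma layer_point_inj h x h' x' :
  layer_point d h x = layer_point d h' x' -> h = h' /\ x =1 x'.
Proof.
move=> xx; split=> [|j].
  by rewrite -(layer_point_height h x) xx layer_point_height.
by apply/succn_inj; rewrite -(layer_point_base h x) xx layer_point_base.
Qed.

Lemma slope_edge_neq a s :
  layer_point d 1 (fun i => L * a i)%N !=
  layer_point d 2 (fun i => L * a i + s i)%N.
Proof. by apply/eqP => /layer_point_inj[]. Qed.

Lemma slope_edge_inj a s a' s' : (0 < L)%N ->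
  slope_edge d L k n a s = slope_edge d L k n a' s' -> a = a' /\ s = s'.
Proof.
move=> L0 ee.
have aa : a = a'.
  have : layer_point d 1 (fun i => L * a i)%N \in slope_edge d L k n a' s'.
    by rewrite -ee !inE eqxx.
  rewrite !inE => /orP[]/eqP/layer_point_inj[]// _ La.
  by apply/ffunP => i; apply/val_inj/eqP; rewrite -(eqn_pmul2l L0); apply/eqP/La.
split=> //.
have : layer_point d 2 (fun i => L * a i + s i)%N \in slope_edge d L k n a' s'.
  by rewrite -ee !inE eqxx orbT.
rewrite !inE => /orP[]/eqP/layer_point_inj[]// _; rewrite aa => ss.
by apply/ffunP => i; apply/val_inj; have /addnI := ss i.
Qed.

(** The height of a point of the segment determines how far along the segment
    it is. *)
Lemma slope_edge_segment a s (z : 'rV[R]_d) :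
  edge_segment (slope_edge d L k n a s) z ->
  exists2 t : R, 0 < t < 1 & z ord0 height_coord = 1 + t /\
    forall j, z ord0 (base_coord j) = (L * a j)%:R + 1 + t * (s j)%:R.
Proof.
rewrite edge_segment2 ?slope_edge_neq// => -[t [t01 ->]]; exists t => //.
split=> [|j]; rewrite !mxE ?layer_point_height ?layer_point_base; first ring.
by rewrite -!natr1 natrD; ring.
Qed.

(** A common point has the same parameter t on both edges, as t is read off its
    height; comparing the first three coordinates gives the ratio L / t > L,
    which is rational because it is a quotient of integer coordinates. *)
Lemma slope_edge_cross a s a' s' : (0 < L)%N ->
  cross R (slope_edge d L k n a s) (slope_edge d L k n a' s') ->
  a' != a /\ collides L a s a' s'.
Proof.
move=> L0 [ee [z []]] /slope_edge_segment[t /andP[t0 t1] [zh zP]].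
move=> /slope_edge_segment[t' _ [+ z'P]].
rewrite zh => /addrI tt; subst t'.
have st j : (s j)%:R - (s' j)%:R = L%:R / t * ((a' j)%:R - (a j)%:R) :> R.
  have := zP j; rewrite z'P !natrM => e.
  apply: (mulfI (lt0r_neq0 t0)); rewrite mulrA mulrCA mulfV ?lt0r_neq0// mulr1.
  by lra.
have a'a : a' != a.
  apply/eqP => aa; apply: ee; rewrite aa; congr slope_edge.
  apply/ffunP => j; apply/val_inj/eqP; rewrite -(eqr_nat R) -subr_eq0 st aa subrr.
  by rewrite mulr0.
split=> //.
have [j0 aj0] : exists j, a' j != a j.
  apply/existsP; apply: contraNT a'a => /existsPn h; apply/eqP/ffunP => j.
  by apply/eqP; have := h j; rewrite negbK.
have rE (x y : nat) : ratr (x%:Z - y%:Z)%:Q = x%:R - y%:R :> R.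
  by rewrite ratr_int rmorphB /= -!pmulrn.
pose r : rat := ((s j0)%:Z - (s' j0)%:Z)%:Q / ((a' j0)%:Z - (a j0)%:Z)%:Q.
have rr : ratr r = L%:R / t :> R.
  rewrite /r fmorph_div /= !rE st mulfK// subr_eq0 eqr_nat.
  by apply: contra aj0 => /eqP/val_inj ->.
apply/asboolP; exists r; split.
  rewrite -(ltr_rat R) rr ratr_nat ltr_pdivlMr//.
  by rewrite gtr_pMr// ltr0n.
by move=> j; apply: (fmorph_inj (ratr : rat -> R)); rewrite rmorphM /= rr !rE st.
Qed.

(** Interior points of an edge have height strictly between 1 and 2. *)
Lemma slope_edge_proper a s (x : lattice_point d) :
  ~ edge_segment (slope_edge d L k n a s) (embed R x).
Proof.
move=> /slope_edge_segment[t /andP[t0 t1] []]; rewrite mxE => ht _.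
have : (1 < (x height_coord)%:R :> R) && ((x height_coord)%:R < 2 :> R).
  by rewrite ht; apply/andP; split; lra.
by rewrite ltr1n ltr_nat; case: (x _) => [|[|?]].
Qed.

Lemma layer_point_grid h x m : (0 < h <= 2)%N -> (forall j, x j < m)%N ->
  layer_point d h x \in grid (@slab d m).
Proof.
move=> h12 xm; rewrite in_grid; apply/forallP => i; rewrite ffunE /slab.
by case: (i < 3)%N; [exact: xm|case: (_ == _)].
Qed.

Lemma slope_graph_crossing_free
    (f : {ffun {ffun 'I_3 -> 'I_k} -> {ffun 'I_3 -> 'I_n}}) : (0 < L)%N ->
  (forall a a', a' != a -> ~~ collides L a (f a) a' (f a')) ->
  slope_graph d L k n f \in crossing_free_graphs R (@slab d (L * k + n)).
Proof.
move=> L0 fP; apply/in_crossing_free_graphs; split; first split.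
- move=> _ /imfsetP[a _ ->] /=; split; last first.
    by rewrite cardfs2 slope_edge_neq.
  rewrite /vertices /slope_graph /=; apply/fsubsetP => x.
  rewrite in_fset2 => /orP[]/eqP->; apply: layer_point_grid => // j.
    by case: (a j) (f a j) => u uk [v vn] /=; nia.
  by case: (a j) (f a j) => u uk [v vn] /=; nia.
- by move=> _ x /imfsetP[a _ ->] _; exact: slope_edge_proper.
- exact: fsubset_refl.
apply/eqP; rewrite cardfs_eq0; apply/eqP/fsetP => p; rewrite !inE /=.
apply/negbTE/negP => /andP[pE /asboolP[e1 [e2 [pe c12]]]].
move: pE; rewrite fpowersetE pe => /fsubsetP pE.
have /imfsetP[a _ /= ea] := pE e1 (fset21 _ _).
have /imfsetP[a' _ /= ea'] := pE e2 (fset22 _ _).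
move: c12; rewrite ea ea' => /(slope_edge_cross _ _ _ _ L0)[a'a col].
by have := fP a a' a'a; rewrite col.
Qed.

Lemma slope_graph_inj : (0 < L)%N -> injective (slope_graph d L k n).
Proof.
move=> L0 f g [] /fsetP fg; apply/ffunP => a.
have /imfsetP[a' _ /= /(slope_edge_inj _ _ _ _ L0)[-> ->//]] :
  slope_edge d L k n a (f a) \in edges (slope_graph d L k n g).
by rewrite -fg; apply/imfsetP; exists a.
Qed.

End Slopes.

Lemma volume_slab d m : (4 <= d)%N -> volume (@slab d m) = (2 * m ^ 3)%N.
Proof.
move=> d4; rewrite /volume.
rewrite -(big_mkord predT
  (fun i => if (i < 3)%N then m else if i == 3 then 2%N else 1%N)).
(* All factors from the fifth on are 1. *)
rewrite (@big_cat_nat _ _ _ 4)//= mulnC big_nat_cond big1 => [|i].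
  by rewrite mul1n unlock /= /reducebig /=; ring.
by case/andP => /andP[i4 _] _; do 4?case: i i4 => // i i4.
Qed.

(** Spacing L = 8 and slope side n = 8 k: at each point at most
    27 n^3 / 64 = 216 k^3 of the 512 k^3 slopes are forbidden. *)
Lemma ncs_lower_bound (R : realType) (d k N : nat) : (4 <= d)%N -> (0 < k)%N ->
  (2 * (16 * k) ^ 3 <= N)%N -> ((k ^ 3) ^ (k ^ 3) <= ncs R d N)%N.
Proof.
move=> d4 k0 kN; pose n := (8 * k)%N.
have nE : (8 * k + n = 16 * k)%N by rewrite /n; lia.
apply: leq_trans (@ncs_ge R d N (@slab d (8 * k + n)) _ _); last first.
- by rewrite volume_slab// nE.
- by move=> i; rewrite /slab; case: ifP => _; [lia|case: ifP].
have n0 : (0 < n)%N by rewrite /n; lia.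
pose s0 : {ffun 'I_3 -> 'I_n} := [ffun=> Ordinal n0].
have free a (f : {ffun {ffun 'I_3 -> 'I_k} -> {ffun 'I_3 -> 'I_n}}) :
  (k ^ 3 <= #|[set s | [forall (a' | a' != a), ~~ collides 8 a s a' (f a')]]|)%N.
  have := card_collisions_le k n 8 a f isT.
  have -> : [set s | [forall (a' | a' != a), ~~ collides 8 a s a' (f a')]] =
      (~: [set s | [exists (a' | a' != a), collides 8 a s a' (f a')]])%SET.
    apply/setP => s; rewrite !inE negb_exists; apply: eq_forallb => a'.
    by rewrite negb_and -implybE.
  rewrite [X in _ -> (_ <= X)%N]cardsCs finset.setCK card_ffun !card_ord.
  rewrite /n expnMn; move: #|_| (k ^ 3)%N => u K.
  by have [-> ->] : (8 ^ 2 = 64 /\ 8 ^ 3 = 512)%N by []; lia.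
have := @greedy_selection _ _ s0 (k ^ 3) (@collides k n 8)
  (@collides_sym k n 8) free.
rewrite card_ffun !card_ord => /leq_trans; apply.
set T := [set f | _].
have <- : #|` [fset slope_graph d 8 k n f | f in T]%fset| = #|T|.
  rewrite card_imfset; last exact: slope_graph_inj.
  by rewrite cardE.
apply/fsubset_leq_card/fsubsetP => _ /imfsetP[f /= fT ->].
apply: slope_graph_crossing_free => // a a' a'a.
by move: fT; rewrite inE => /forallP/(_ a)/forall_inP; apply.
Qed.

(** * Asymptotics *)

Lemma powR_le_natexp (R : realType) (D N M : nat) : (0 < D)%N -> (0 < N)%N ->
  (N <= D * M)%N -> (N <= M ^ 2)%N ->
  2 `^ ((2 * D%:R)^-1 * N%:R * ln N%:R) <= (M ^ M)%:R :> R.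
Proof.
move=> D0 N0 NDM NM2.
have M0 : (0 < M)%N by nia.
have MR : 0 < M%:R :> R by rewrite ltr0n.
have DR : 0 < D%:R :> R by rewrite ltr0n.
have lnN0 : 0 <= ln N%:R :> R by rewrite ln_ge0// ler1n.
have lnN : ln N%:R <= 2 * ln M%:R :> R.
  rewrite mulr_natl -lnXn// -natrX ler_ln ?posrE ?ltr0n ?expn_gt0 ?M0//.
  by rewrite ler_nat.
have ln2 : ln 2 <= 1 :> R by rewrite (le_trans (le_ln1Dx _))//; lra.
have ln20 : 0 <= ln 2 :> R by rewrite ln_ge0// ler1n.
have NR : N%:R <= D%:R * M%:R :> R by rewrite -natrM ler_nat.
rewrite natrX -ler_ln ?posrE ?powR_gt0 ?exprn_gt0// ln_powR lnXn//.
rewrite -[leRHS]mulr_natl.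
apply: (@le_trans _ _ ((2 * D%:R)^-1 * N%:R * ln N%:R)).
  by rewrite ler_piMr// !mulr_ge0// invr_ge0 mulr_ge0.
apply: (@le_trans _ _ ((2 * D%:R)^-1 * (D%:R * M%:R) * (2 * ln M%:R))).
  by apply: ler_pM => //; rewrite ler_wpM2l// invr_ge0 mulr_ge0.
by rewrite le_eqVlt; apply/orP; left; apply/eqP; field; rewrite lt0r_neq0.
Qed.

Lemma cubes_cofinal (C N : nat) : (0 < C)%N -> (C <= N)%N ->
  exists k, [/\ (0 < k)%N, (C * k ^ 3 <= N)%N & (N <= 8 * C * k ^ 3)%N].
Proof.
move=> C0 CN; pose P k := (C * k ^ 3 <= N)%N.
have P1 : exists k, P k by exists 1%N; rewrite /P exp1n muln1.
have Pbound k : P k -> (k <= N)%N.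
  move=> kN; apply: leq_trans kN; apply: leq_trans (leq_pmull _ C0).
  by case: k => // k; apply: (@leq_pexp2l _ 1 3).
have [k kN kmax] := ex_maxnP P1 Pbound; exists k.
have k0 : (0 < k)%N by apply: kmax; rewrite /P exp1n muln1.
split=> //; apply: (@leq_trans (C * k.+1 ^ 3)).
  by rewrite leqNgt; apply: contraTN (ltnSn k) => /ltnW/kmax; rewrite -leqNgt.
rewrite [(8 * C)%N]mulnC -mulnA leq_mul2l; apply/orP; right.
by rewrite -[8%N]/(2 ^ 3)%N -expnMn leq_exp2r//; lia.
Qed.

Theorem theorem5 (R : realType) (d : nat) (d_ge4 : (4 <= d)%N) :
  exists c : R, 0 < c /\
    exists Nd : nat, forall N : nat, (Nd <= N)%N ->
      2 `^ (c * N%:R * ln N%:R) <= (ncs R d N)%:R :> R.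
Proof.
(* C k^3 is the volume of the two-layer grid; it is kept abstract so that no
   large numeral in unary is ever evaluated. *)
have [C C0 CE] : exists2 C : nat, (0 < C)%N & C = (2 * 16 ^ 3)%N by exists (2 * 16 ^ 3)%N.
have D0 : (0 < 8 * C)%N by rewrite muln_gt0.
exists (2 * (8 * C)%:R)^-1; split; first by rewrite invr_gt0 mulr_gt0// ltr0n.
exists ((8 * C) ^ 2)%N => N DN.
have CN : (C <= N)%N by nia.
have [k [k0 kN Nk]] := cubes_cofinal C N C0 CN.
apply: (@le_trans _ _ ((k ^ 3) ^ (k ^ 3))%:R); last first.
  by rewrite ler_nat; apply: ncs_lower_bound => //; rewrite expnMn mulnA -CE.
have N0 : (0 < N)%N := leq_trans C0 CN.
apply: powR_le_natexp => //.
(* With D = 8 C, N <= D k^3 and D^2 <= N give N D^2 <= N^2 <= D^2 (k^3)^2. *)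
rewrite -(leq_pmul2l N0); move: DN Nk; move: (8 * C)%N (k ^ 3)%N => D M DN NM.
by apply: (@leq_trans ((D * M) ^ 2)); nia.
Qed.
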